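(* Let $\hbar\neq 0$ and $t_2$ be constants, and let $(q_1,q_2,p_1,p_2)=(q_1(t_1),q_2(t_1),p_1(t_1),p_2(t_1))$ be the convergent Laurent series solution at $t_1=\alpha$ of the Hamiltonian system of type $9/2$ in $t_1$, with free parameters $(\alpha,\beta,\gamma,\delta)$ independent of $t_1$, given in the context. Then, with this solution substituted, the functions $Q_{\mathrm{Gar}_{9/2}}(x,t_1,t_2)$ and $A_{\mathrm{Gar}_{9/2},2}(x,t_1,t_2)$ have finite limits as $t_1\to\alpha$: $$\lim_{t_1\to\alpha}Q_{\mathrm{Gar}_{9/2}}(x,t_1,t_2)=R_0(x,t_2)+\hbar R_1(x,t_2)+\hbar^2R_2(x,t_2),\qquad \lim_{t_1\to\alpha}A_{\mathrm{Gar}_{9/2},2}(x,t_1,t_2)=\frac{2}{2x-3\beta},$$ where $$R_0=x^5+3t_2x^3-\alpha x^2+\frac{3(9072t_2^2+8000\alpha\beta-34560t_2\beta^2-51975\beta^4-15120\delta)}{12320}\,x-\frac{9(9072t_2^2\beta+1840\alpha\beta^2-6840t_2\beta^3-31185\beta^5-221760\gamma^2-15120\beta\delta)}{24640},$$ $$R_1=\frac{18\gamma}{2x-3\beta},\qquad R_2=\frac{3}{(2x-3\beta)^2}.$$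
   Context: **Hamiltonian system of type $9/2$ in $t_1$** ($t_2$ constant): $\hbar\,dq_i/dt_1=\partial H_1/\partial p_i$, $\hbar\,dp_i/dt_1=-\partial H_1/\partial q_i$ ($i=1,2$), with $$H_1=p_1^4+3p_1^2p_2+p_1q_2^2-2q_1q_2+p_2^2-t_1p_1+t_2p_2.$$ **Laurent series solution.** This system is known to have a convergent Laurent series solution at $t_1=\alpha$, containing the free parameters $(\alpha,\beta,\gamma,\delta)$, of the form (write $s=t_1-\alpha$) $$\begin{aligned}q_1={}&-\frac{\hbar^5}{s^5}+\frac{\beta\hbar^3}{s^3}+\gamma+\frac{(10\alpha-18t_2\beta-35\beta^3)s}{70\hbar}-\frac{3(50\beta\gamma-3\hbar)s^2}{20\hbar^2}+\frac{\delta s^3}{\hbar^3}-\frac{(-36t_2\gamma+105\beta^2\gamma-5\beta\hbar)s^4}{14\hbar^4}+O(s^5),\end{aligned}$$ $$\begin{aligned}q_2={}&-\frac{\hbar^3}{s^3}-\frac{3(4t_2+5\beta^2)s}{20\hbar}-\frac{6\gamma s^2}{\hbar^2}+\frac{(4\alpha-24t_2\beta-35\beta^3)s^3}{14\hbar^3}+\frac{(-30\beta\gamma+\hbar)s^4}{4\hbar^4}\\&+\frac{3(1008t_2^2+400\alpha\beta+120t_2\beta^2-1925\beta^4+1400\delta)s^5}{15400\hbar^5}+O(s^6),\end{aligned}$$ $$\begin{aligned}p_1={}&\frac{\hbar^2}{s^2}+\frac{\beta}{2}-\frac{3(4t_2+5\beta^2)s^2}{20\hbar^2}-\frac{4\gamma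 s^3}{\hbar^3}+\frac{(4\alpha-24t_2\beta-35\beta^3)s^4}{28\hbar^4}+\frac{(-30\beta\gamma+\hbar)s^5}{10\hbar^5}\\&+\frac{(1008t_2^2+400\alpha\beta+120t_2\beta^2-1925\beta^4+1400\delta)s^6}{15400\hbar^6}+O(s^7),\end{aligned}$$ $$\begin{aligned}p_2={}&-\frac{3\beta\hbar^2}{2s^2}+\Bigl(t_2+\frac{3\beta^2}{2}\Bigr)+\frac{6\gamma s}{\hbar}+\frac{9(4t_2\beta+5\beta^3)s^2}{40\hbar^2}+\frac{s^3}{5\hbar^2}\\&-\frac{3(1008t_2^2+400\alpha\beta+120t_2\beta^2-1925\beta^4-1680\delta)s^4}{12320\hbar^4}-\frac{9(32t_2\gamma+70\beta^2\gamma-\beta\hbar)s^5}{140\hbar^5}+O(s^6).\end{aligned}$$ **Isomonodromy system.** Let $L=(L_{ij})$ be the $2\times2$ matrix with entries $$L_{11}=-L_{22}=q_2x+q_1-p_1q_2,\qquad L_{21}=x^2-p_1x-p_2+t_2,$$ $$L_{12}=x^3+p_1x^2+(p_1^2+p_2+2t_2)x+p_1^3+2p_1p_2-q_2^2+t_2p_1-t_1,$$ and let $M_{2,12}=x^2+p_1x+p_1^2+2p_2+t_2$ (the $(1,2)$-entry of the matrix $M_2$ in the deformation equation $\hbar\,\partial\Phi/\partial t_2=M_2\Phi$ of $\hbar\,\partial\Phi/\partial x=L\Phi$). **Schrödinger form.** Put $$P_1=-L_{11}-L_{22}-\frac{\hbar}{L_{12}}\frac{\partial L_{12}}{\partial x},\qquad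 P_2=L_{11}L_{22}-L_{12}L_{21}+\hbar\Bigl(-\frac{\partial L_{11}}{\partial x}+\frac{L_{11}}{L_{12}}\frac{\partial L_{12}}{\partial x}\Bigr),$$ $$Q_{\mathrm{Gar}_{9/2}}=-P_2+\frac{P_1^2}{4}+\frac{\hbar}{2}\frac{\partial P_1}{\partial x},\qquad A_{\mathrm{Gar}_{9/2},2}=\frac{M_{2,12}}{L_{12}}.$$ These are rational functions of $x$; the limits are taken for fixed $x$ with $2x\neq3\beta$. *)

(* Defs.v *)
(* The definitions are generic in a numFieldType K, which
   carries the topology of its norm; the theorem takes K = Cplx R.
   Numerals above 5000 carry an explicit %:R: they are then read in nat_scope,
   where they are kept as decimal Nat.of_num_uint literals, whereas ring_scope
   would expand them in unary. *)
From HB Require Import structures.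
From mathcomp Require Import all_boot all_order all_algebra.
From mathcomp Require Import all_classical all_reals all_analysis.
From mathcomp Require Import complex.

Set Implicit Arguments.
Unset Strict Implicit.
Unset Printing Implicit Defensive.

Import Order.TTheory GRing.Theory Num.Theory.
Import numFieldNormedType.Exports.

Local Open Scope classical_set_scope.
Local Open Scope ring_scope.

(* The complex numbers R[i].  Seen as a numFieldType they inherit the norm
   topology, which is not found by inference on the bare type R[i]. *)
Definition Cplx (R : realType) : numFieldType := R[i].

Definition H1 (K : numFieldType) (t1 t2 q1 q2 p1 p2 : K) : K :=
  p1 ^+ 4 + 3 * p1 ^+ 2 * p2 + p1 * q2 ^+ 2 - 2 * q1 * q2 + p2 ^+ 2
  - t1 * p1 + t2 * p2.

Definition hamiltonian_at (K : numFieldType) (hbar t2 : K)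
    (q1 q2 p1 p2 : K -> K) (t : K) : Prop :=
  [/\ derivable q1 t 1, derivable q2 t 1, derivable p1 t 1
    & derivable p2 t 1] /\
  [/\ hbar * derive1 q1 t
        = derive1 (fun u => H1 t t2 (q1 t) (q2 t) u (p2 t)) (p1 t),
      hbar * derive1 q2 t
        = derive1 (fun u => H1 t t2 (q1 t) (q2 t) (p1 t) u) (p2 t),
      hbar * derive1 p1 t
        = - derive1 (fun u => H1 t t2 u (q2 t) (p1 t) (p2 t)) (q1 t)
    & hbar * derive1 p2 t
        = - derive1 (fun u => H1 t t2 (q1 t) u (p1 t) (p2 t)) (q2 t)].

(* f(t) = head(s) + O(s^m) with s = t - alpha, where O(s^m) stands for a power
   series in s starting at s^m which converges on a punctured neighbourhood of
   alpha.  Below, head is always a Laurent polynomial, so this says that f is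
   the sum of a convergent Laurent series whose terms of order < m are the
   terms of head. *)
Definition laurent_expansion (K : numFieldType) (alpha : K) (f head : K -> K)
    (m : nat) : Prop :=
  exists a : nat -> K, \forall t \near alpha^',
    series (fun n => a n * (t - alpha) ^+ (m + n)) @ \oo
      --> f t - head (t - alpha).

Section heads.
Context (K : numFieldType) (hbar t2 alpha beta gamma delta : K).

Definition q1_head (s : K) : K :=
  - (hbar ^+ 5 / s ^+ 5) + beta * hbar ^+ 3 / s ^+ 3 + gamma
  + (10 * alpha - 18 * t2 * beta - 35 * beta ^+ 3) * s / (70 * hbar)
  - 3 * (50 * beta * gamma - 3 * hbar) * s ^+ 2 / (20 * hbar ^+ 2)
  + delta * s ^+ 3 / hbar ^+ 3
  - (- 36 * t2 * gamma + 105 * beta ^+ 2 * gamma - 5 * beta * hbar) * s ^+ 4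
    / (14 * hbar ^+ 4).

Definition q2_head (s : K) : K :=
  - (hbar ^+ 3 / s ^+ 3)
  - 3 * (4 * t2 + 5 * beta ^+ 2) * s / (20 * hbar)
  - 6 * gamma * s ^+ 2 / hbar ^+ 2
  + (4 * alpha - 24 * t2 * beta - 35 * beta ^+ 3) * s ^+ 3
    / (14 * hbar ^+ 3)
  + (- 30 * beta * gamma + hbar) * s ^+ 4 / (4 * hbar ^+ 4)
  + 3 * (1008 * t2 ^+ 2 + 400 * alpha * beta + 120 * t2 * beta ^+ 2
         - 1925 * beta ^+ 4 + 1400 * delta) * s ^+ 5
    / (15400%:R * hbar ^+ 5).

Definition p1_head (s : K) : K :=
  hbar ^+ 2 / s ^+ 2 + beta / 2
  - 3 * (4 * t2 + 5 * beta ^+ 2) * s ^+ 2 / (20 * hbar ^+ 2)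
  - 4 * gamma * s ^+ 3 / hbar ^+ 3
  + (4 * alpha - 24 * t2 * beta - 35 * beta ^+ 3) * s ^+ 4
    / (28 * hbar ^+ 4)
  + (- 30 * beta * gamma + hbar) * s ^+ 5 / (10 * hbar ^+ 5)
  + (1008 * t2 ^+ 2 + 400 * alpha * beta + 120 * t2 * beta ^+ 2
     - 1925 * beta ^+ 4 + 1400 * delta) * s ^+ 6
    / (15400%:R * hbar ^+ 6).

Definition p2_head (s : K) : K :=
  - (3 * beta * hbar ^+ 2 / (2 * s ^+ 2))
  + (t2 + 3 * beta ^+ 2 / 2)
  + 6 * gamma * s / hbar
  + 9 * (4 * t2 * beta + 5 * beta ^+ 3) * s ^+ 2 / (40 * hbar ^+ 2)
  + s ^+ 3 / (5 * hbar ^+ 2)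
  - 3 * (1008 * t2 ^+ 2 + 400 * alpha * beta + 120 * t2 * beta ^+ 2
         - 1925 * beta ^+ 4 - 1680 * delta) * s ^+ 4
    / (12320%:R * hbar ^+ 4)
  - 9 * (32 * t2 * gamma + 70 * beta ^+ 2 * gamma - beta * hbar) * s ^+ 5
    / (140 * hbar ^+ 5).

Definition laurent_solution (q1 q2 p1 p2 : K -> K) : Prop :=
  (\forall t \near alpha^', hamiltonian_at hbar t2 q1 q2 p1 p2 t) /\
  [/\ laurent_expansion alpha q1 q1_head 5,
      laurent_expansion alpha q2 q2_head 6,
      laurent_expansion alpha p1 p1_head 7
    & laurent_expansion alpha p2 p2_head 6].

End heads.

Section schroedinger.
Context (K : numFieldType) (hbar t1 t2 q1 q2 p1 p2 : K).

Definition L11 (x : K) : K := q2 * x + q1 - p1 * q2.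

Definition L12 (x : K) : K :=
  x ^+ 3 + p1 * x ^+ 2 + (p1 ^+ 2 + p2 + 2 * t2) * x
  + p1 ^+ 3 + 2 * p1 * p2 - q2 ^+ 2 + t2 * p1 - t1.

Definition L21 (x : K) : K := x ^+ 2 - p1 * x - p2 + t2.

Definition L22 (x : K) : K := - L11 x.

Definition M2_12 (x : K) : K :=
  x ^+ 2 + p1 * x + p1 ^+ 2 + 2 * p2 + t2.

Definition P1 (x : K) : K :=
  - L11 x - L22 x - hbar / L12 x * derive1 L12 x.

Definition P2 (x : K) : K :=
  L11 x * L22 x - L12 x * L21 x
  + hbar * (- derive1 L11 x + L11 x / L12 x * derive1 L12 x).

Definition QGar92 (x : K) : K :=
  - P2 x + P1 x ^+ 2 / 4 + hbar / 2 * derive1 P1 x.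

Definition AGar92_2 (x : K) : K := M2_12 x / L12 x.

End schroedinger.

Section limits.
Context (K : numFieldType) (t2 alpha beta gamma delta : K).

Definition R0 (x : K) : K :=
  x ^+ 5 + 3 * t2 * x ^+ 3 - alpha * x ^+ 2
  + 3 * (9072%:R * t2 ^+ 2 + 8000%:R * alpha * beta - 34560%:R * t2 * beta ^+ 2
         - 51975%:R * beta ^+ 4 - 15120%:R * delta) / 12320%:R * x
  - 9 * (9072%:R * t2 ^+ 2 * beta + 1840 * alpha * beta ^+ 2
         - 6840%:R * t2 * beta ^+ 3 - 31185%:R * beta ^+ 5
         - 221760%:R * gamma ^+ 2 - 15120%:R * beta * delta) / 24640%:R.

Definition R1 (x : K) : K := 18 * gamma / (2 * x - 3 * beta).

Definition R2 (x : K) : K := 3 / (2 * x - 3 * beta) ^+ 2.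

End limits.

(* Main.v *)
(* Set v = (t - alpha) / hbar.  Multiplied by suitable powers of v, the functions
   q_i, p_i and then L11, L12, L21 become power series in v, known up to a
   remainder o(v^n).  Their leading terms cancel: L11 has a pole of order 3 and
   L12 one of order 4, with v^4 L12 -> y := x - 3 beta / 2.  In
     Q = (L11^2 + L12 L21) + hbar (q2 - L11 L12'/L12)
         + hbar^2 (3/4 (L12'/L12)^2 - L12''/(2 L12))
   the first two terms have simple poles - hbar y / v and hbar y / v, which cancel;
   the limits are then read off the coefficients. *)
Require Import Defs.
From mathcomp Require Import all_boot all_order all_algebra.
From mathcomp Require Import all_classical all_reals all_analysis.
From mathcomp Require Import ring.
Import Order.TTheory GRing.Theory Num.Theory.
Import numFieldNormedType.Exports.
Local Open Scope classical_set_scope.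
Local Open Scope ring_scope.

Set Implicit Arguments.
Unset Strict Implicit.
Unset Printing Implicit Defensive.

(** * Expansions to order n in powers of a function u tending to 0 *)

Section jets.
Context {K : numFieldType} {T : Type} {F : set_system T} {FF : Filter F}.
Context {u : T -> K} (u0 : u @ F --> (0 : K)) (uN0 : \forall t \near F, u t != 0).
Implicit Types (f g : T -> K) (p q : {poly K}) (n : nat).

(** This is [f = p(u) + o(u^n)]. The degree of [p] is not bounded by n, so sums and products of jets
    need no truncation; only the coefficients up to n are significant. *)
Definition jet n f p := exists2 e : T -> K, e @ F --> (0 : K) &
  \forall t \near F, f t = p.[u t] + u t ^+ n * e t.

Lemma cvg_horner (g : T -> K) l p : g @ F --> l -> p.[g t] @[t --> F] --> p.[l].
Proof.
move=> gl; elim/poly_ind: p => [|p c ih].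
  by under eq_fun do rewrite horner0; rewrite horner0; exact: cvg_cst.
under eq_fun do rewrite !hornerE; rewrite !hornerE.
by apply: cvgD; [exact: cvgM|exact: cvg_cst].
Qed.

Lemma cvg_pow_u n : u t ^+ n @[t --> F] --> (0 : K) ^+ n.
Proof. by rewrite -hornerXn; under eq_fun do rewrite -hornerXn; exact: cvg_horner. Qed.

Lemma jetC n c : jet n (fun=> c) c%:P.
Proof.
exists (cst 0); first exact: cvg_cst.
by apply: nearW => t; rewrite hornerC mulr0 addr0.
Qed.

Lemma jetXn n k : jet n (fun t => u t ^+ k) 'X^k.
Proof.
exists (cst 0); first exact: cvg_cst.
by apply: nearW => t; rewrite hornerXn mulr0 addr0.
Qed.

Lemma jetD n f g p q : jet n f p -> jet n g q ->
  jet n (fun t => f t + g t) (p + q).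
Proof.
move=> [e e0 fe] [d d0 gd]; exists (fun t => e t + d t).
  by rewrite -[0]addr0; exact: cvgD.
by apply: filterS2 fe gd => t -> ->; rewrite hornerD; ring.
Qed.

Lemma jetB n f g p q : jet n f p -> jet n g q ->
  jet n (fun t => f t - g t) (p - q).
Proof.
move=> [e e0 fe] [d d0 gd]; exists (fun t => e t - d t).
  by rewrite -[0]subr0; exact: cvgB.
by apply: filterS2 fe gd => t -> ->; rewrite hornerD hornerN; ring.
Qed.

Lemma jetM n f g p q : jet n f p -> jet n g q ->
  jet n (fun t => f t * g t) (p * q).
Proof.
move=> [e e0 fe] [d d0 gd].
exists (fun t => p.[u t] * d t + e t * (q.[u t] + u t ^+ n * d t)).
  suff : p.[u t] * d t + e t * (q.[u t] + u t ^+ n * d t) @[t --> F]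
      --> p.[0] * 0 + 0 * (q.[0] + 0 ^+ n * 0) by rewrite mulr0 mul0r addr0.
  apply: cvgD; apply: cvgM => //; first exact: cvg_horner.
  by apply: cvgD; [exact: cvg_horner|apply: cvgM => //; exact: cvg_pow_u].
by apply: filterS2 fe gd => t -> ->; rewrite hornerM; ring.
Qed.

Lemma jet_near n f g p : (\forall t \near F, f t = g t) -> jet n f p -> jet n g p.
Proof.
move=> fg [e e0 fe]; exists e => //; by apply: filterS2 fg fe => t <-.
Qed.

Lemma jet_trunc m n f p q : (m <= n)%N -> (forall i, (i <= m)%N -> p`_i = q`_i) ->
  jet n f p -> jet m f q.
Proof.
move=> mn pq [e e0 fe].
exists (fun t => u t * (drop_poly m.+1 (p - q)).[u t] + u t ^+ (n - m) * e t).
  suff : u t * (drop_poly m.+1 (p - q)).[u t] + u t ^+ (n - m) * e t @[t --> F]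
      --> 0 * (drop_poly m.+1 (p - q)).[0] + 0 ^+ (n - m) * 0.
    by rewrite mulr0 mul0r addr0.
  by apply: cvgD; apply: cvgM => //; [exact: cvg_horner|exact: cvg_pow_u].
(* The difference [p - q] is divisible by ['X^(m.+1)]: one factor u makes it tend to 0, the other m
   go into the remainder. *)
have pqE : p = q + drop_poly m.+1 (p - q) * 'X^(m.+1).
  rewrite addrC -[LHS](subrK q); congr (_ + q).
  rewrite -[LHS](poly_take_drop m.+1) -[RHS]add0r; congr (_ + _).
  apply/polyP => i; rewrite coef_take_poly coef0 coefB ltnS.
  by case: leqP => // /pq->; rewrite subrr.
apply: filterS fe => t ->; rewrite {1}pqE hornerD hornerM hornerXn.
by rewrite -{1}(subnKC mn) exprD exprS; ring.
Qed.

(** This turns cancellation of leading terms into a lower pole order: k vanishing coefficients are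
    traded for a division by [u^k], at the cost of k orders of precision. *)
Lemma jet_div k n f g p q : (\forall t \near F, g t = u t ^+ k * f t) ->
  (forall i, (i < k)%N -> p`_i = 0) ->
  (forall i, (i <= n)%N -> p`_(k + i) = q`_i) -> jet (k + n) g p -> jet n f q.
Proof.
move=> gf pk pq [e e0 ge].
suff : jet n f (drop_poly k p).
  by apply: jet_trunc => // i /pq; rewrite coef_drop_poly addnC.
exists e => //; apply: filterS3 uN0 gf ge => t utN0 -> fe.
apply: (mulfI (expf_neq0 k utN0)); rewrite fe -{1}(poly_take_drop k p).
rewrite (_ : take_poly k p = 0) ?add0r; last first.
  by apply/polyP => i; rewrite coef_take_poly coef0; case: ifP => // /pk.
by rewrite hornerM hornerXn exprD; ring.
Qed.

Lemma jet_cvg n f p l : jet n f p -> p`_0 = l -> f @ F --> l.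
Proof.
move=> [e e0 fe] <-; rewrite -horner_coef0.
have fe' : {near F, (fun t => p.[u t] + u t ^+ n * e t) =1 f}.
  by apply: filterS fe => t ->.
apply: cvg_trans (near_eq_cvg fe') _.
suff : p.[u t] + u t ^+ n * e t @[t --> F] --> p.[0] + 0 ^+ n * 0.
  by rewrite mulr0 addr0.
by apply: cvgD; [exact: cvg_horner|apply: cvgM => //; exact: cvg_pow_u].
Qed.

End jets.
Arguments jet {K T} F u n f p.
Arguments jetC {K T F FF u n} c.
Arguments jetXn {K T F FF u n} k.

(** * From convergent Laurent series to remainders *)

(** The terms of a series converging at one point [t0] are bounded there; nearer to alpha a
    geometric series dominates, so the tail is O(s^(m+1)), hence o(s^m). *)
Lemma laurent_remainder (K : numFieldType) (alpha : K) (f head : K -> K) m :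
  laurent_expansion alpha f head m.+1 ->
  exists2 e : K -> K, e @ alpha^' --> (0 : K) &
    \forall t \near alpha^', f t = head (t - alpha) + (t - alpha) ^+ m * e t.
Proof.
move=> [a fE].
have tN : \forall t \near alpha^', t != alpha by exact: nbhs_dnbhs_neq.
have [t0 [t0N cv0]] : exists t0, t0 != alpha /\
    series (fun n => a n * (t0 - alpha) ^+ (m.+1 + n)) @ \oo --> f t0 - head (t0 - alpha).
  by apply: (@filter_ex _ alpha^'); apply: filterS2 tN fE.
have r0 : 0 < `|t0 - alpha| by rewrite normr_gt0 subr_eq0.
have [M M0 aM] : exists2 M, 0 < M & forall n, `|a n| * `|t0 - alpha| ^+ (m.+1 + n) <= M.
  have /cvgP/cvg_seq_bounded/ex_strict_bound_gt0 := cvg_series_cvg_0 (cvgP _ cv0).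
  move=> [M M0 aM]; exists M => // n; rewrite -normrX -normrM.
  by apply: ltW; exact: aM.
set r := `|t0 - alpha| in r0 aM.
(* Domination by a geometric series of ratio |t - alpha| / r <= 1/2. *)
have psum t n : `|t - alpha| <= r / 2 ->
    `|series (fun n => a n * (t - alpha) ^+ (m.+1 + n)) n|
    <= M * (`|t - alpha| / r) ^+ m.+1 * (2 - 2 / 2 ^+ n).
  move=> tr; elim: n => [|n ih].
    by rewrite /series/= big_geq// normr0 expr0 divr1 subrr mulr0.
  rewrite seriesSr; apply: le_trans (ler_normD _ _) _.
  pose q := `|t - alpha| / r.
  have q0 : 0 <= q by rewrite divr_ge0// ltW.
  (* [2 - 2 / 2 ^+ n] is the sum of [2^-k] over k < n, so passing to n+1 adds [2^-n]. *)
  have -> : M * q ^+ m.+1 * (2 - 2 / 2 ^+ n.+1) =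
      M * q ^+ m.+1 * (2 - 2 / 2 ^+ n) + M * q ^+ m.+1 * 2^-1 ^+ n.
    rewrite -mulrDr [2 ^+ n.+1]exprS invfM mulrA divff ?pnatr_eq0// exprVn; ring.
  apply: lerD => //; rewrite normrM normrX.
  have -> : `|t - alpha| = r * q by rewrite /q mulrC divfK// gt_eqF.
  rewrite exprMn mulrA -[leRHS]mulrA.
  apply: ler_pM => //; rewrite ?mulr_ge0 ?exprn_ge0//; first exact: ltW.
  rewrite exprD; apply: ler_wpM2l; first exact: exprn_ge0.
  rewrite lerXn2r ?nnegrE ?invr_ge0//.
  by rewrite /q ler_pdivrMr// mulrC.
have near_le d : 0 < d -> \forall t \near alpha^', `|t - alpha| <= d.
  by move=> d0; apply: cvg_within; exact: (@cvgr_distC_le _ K _ (nbhs alpha) _ id).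
have C0 : 0 < 3 * M / r ^+ m.+1 by rewrite divr_gt0 ?mulr_gt0 ?exprn_gt0.
exists (fun t => (f t - head (t - alpha)) / (t - alpha) ^+ m); last first.
  apply: filterS tN => t tN; rewrite mulrC divfK ?subrKC//.
  by rewrite expf_neq0// subr_eq0.
apply/cvgr0Pnorm_le => eps eps0; near=> t.
have tNa : t != alpha by near: t.
have s0 : 0 < `|t - alpha| by rewrite normr_gt0 subr_eq0.
have B0 : 0 < M * (`|t - alpha| / r) ^+ m.+1.
  by rewrite mulr_gt0// exprn_gt0// divr_gt0.
have ft : series (fun n => a n * (t - alpha) ^+ (m.+1 + n)) @ \oo
    --> f t - head (t - alpha) by near: t.
(* One partial sum within [M * (|s| / r)^(m+1)] of the limit, together with twice that bound from
   [psum], gives the factor 3 below. *)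
have [n Sn] := filter_ex ((cvgrPdist_le _ _).1 ft _ B0).
rewrite normrM normfV normrX ler_pdivrMr ?exprn_gt0//.
apply: (@le_trans _ _ (3 * (M * (`|t - alpha| / r) ^+ m.+1))).
  rewrite -[X in `|X|](subrK (series (fun n => a n * (t - alpha) ^+ (m.+1 + n)) n)).
  apply: le_trans (ler_normD _ _) _.
  rewrite (_ : 3 = 1 + 2) // mulrDl mul1r lerD// mulrC.
  apply: le_trans (psum t n _) _; first by near: t; apply: near_le; rewrite divr_gt0.
  apply: ler_wpM2l.
    by rewrite mulr_ge0 ?exprn_ge0 ?divr_ge0// ltW.
  by rewrite lerBlDr lerDl divr_ge0// exprn_ge0.
have : `|t - alpha| <= eps / (3 * M / r ^+ m.+1).
  by near: t; apply: near_le; rewrite divr_gt0.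
rewrite ler_pdivlMr// => /(ler_wpM2r (exprn_ge0 m (ltW s0))); apply: le_trans.
rewrite le_eqVlt; apply/orP; left; apply/eqP.
by rewrite expr_div_n [`|t - alpha| ^+ m.+1]exprS; ring.
Unshelve. all: by end_near.
Qed.

(** * Derivatives in x and a closed form of Q *)

Lemma is_derive_horner (K : numFieldType) (p : {poly K}) (x : K) :
  is_derive x (1 : K) (horner p) p^`().[x].
Proof.
elim/poly_ind: p => [|p c ih].
  rewrite deriv0 horner0 (_ : horner 0 = cst 0); last first.
    by apply/funext => y; rewrite horner0.
  exact: is_derive_cst.
rewrite (_ : horner _ = horner p * id + cst c); last first.
  by apply/funext => y; rewrite !hornerE.
apply: is_derive_eq; rewrite !poly.derivE hornerE.
by rewrite /GRing.scale/= hornerM hornerX; ring.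
Qed.

Lemma derive1_horner (K : numFieldType) (p : {poly K}) (x : K) :
  derive1 (horner p) x = p^`().[x].
Proof. by rewrite derive1E; have [_ ->] := is_derive_horner p x. Qed.

Lemma derive1_horner_ratio (K : numFieldType) (c : K) (p q : {poly K}) (x : K) :
  q.[x] != 0 ->
  derive1 (fun y => c / q.[y] * p.[y]) x
    = c * (p^`().[x] / q.[x] - p.[x] * q^`().[x] / q.[x] ^+ 2).
Proof.
move=> qN0; have [dp dpE] := is_derive_horner p x.
have [dq dqE] := is_derive_horner q x.
rewrite derive1E (_ : (fun y => _) =
    (c *: ((fun y => q.[y]^-1) * horner p))); last first.
  by apply/funext => y; rewrite -mulrA.
have dqV := derivableV qN0 dq.
rewrite deriveZ; last exact: derivableM.
rewrite deriveM// deriveV// dpE dqE /GRing.scale/=.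
by field.
Qed.

Definition dL12 (K : numFieldType) (t2 p1 p2 x : K) : K :=
  3 * x ^+ 2 + 2 * p1 * x + (p1 ^+ 2 + p2 + 2 * t2).

(** Since [L11 + L22 = 0], [P1] reduces to [- hbar L12'/L12]. The terms free of [hbar] and linear in
    it share one denominator, because their poles cancel only in the sum. *)
Lemma QGar92E (K : numFieldType) (hbar t1 t2 q1 q2 p1 p2 x : K) :
  L12 t1 t2 q2 p1 p2 x != 0 ->
  QGar92 hbar t1 t2 q1 q2 p1 p2 x =
    ((L11 q1 q2 p1 x ^+ 2 + L12 t1 t2 q2 p1 p2 x * L21 t2 p1 p2 x)
       * L12 t1 t2 q2 p1 p2 x
     + hbar * (q2 * L12 t1 t2 q2 p1 p2 x - L11 q1 q2 p1 x * dL12 t2 p1 p2 x))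
      / L12 t1 t2 q2 p1 p2 x
    + hbar ^+ 2 * (3 / 4 * (dL12 t2 p1 p2 x / L12 t1 t2 q2 p1 p2 x) ^+ 2
                   - (3 * x + p1) / L12 t1 t2 q2 p1 p2 x).
Proof.
pose q := Poly [:: p1 ^+ 3 + 2 * p1 * p2 - q2 ^+ 2 + t2 * p1 - t1;
                   p1 ^+ 2 + p2 + 2 * t2; p1; 1].
have L12E : L12 t1 t2 q2 p1 p2 = horner q.
  by apply/funext => y; rewrite /q /L12/= !cons_poly_def !hornerE /=; ring.
have dL12E : derive1 (L12 t1 t2 q2 p1 p2) = horner q^`().
  by apply/funext => y; rewrite L12E derive1_horner.
have q'E : q^`().[x] = dL12 t2 p1 p2 x.
  rewrite /q /dL12/= !cons_poly_def !poly.derivE !hornerE /=; ring.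
have q''E : q^`()^`().[x] = 6 * x + 2 * p1.
  rewrite /q/= !cons_poly_def !poly.derivE !hornerE /=; ring.
have dL11E : derive1 (L11 q1 q2 p1) x = q2.
  rewrite (_ : L11 q1 q2 p1 = horner (Poly [:: q1 - p1 * q2; q2])).
    by rewrite derive1_horner /= !cons_poly_def !poly.derivE !hornerE /=; ring.
  by apply/funext => y; rewrite /L11 /= !cons_poly_def !hornerE /=; ring.
have dP1E : P1 hbar t1 t2 q1 q2 p1 p2 = fun y => - hbar / q.[y] * q^`().[y].
  by apply/funext => y; rewrite /P1 dL12E L12E /L22; ring.
rewrite /QGar92 dP1E L12E => qN0; rewrite derive1_horner_ratio//.
rewrite /P2 dL12E dL11E L12E q'E q''E /L22.
by field.
Qed.

(** * Computing coefficients of products *)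

(** A [foldr] over [iota] unfolds by simplification on concrete lists, leaving an expression that
    [field] can treat. *)
Definition cauchy (K : nzRingType) (a b : seq K) (i : nat) : K :=
  foldr (fun j c => a`_j * b`_(i - j) + c) 0 (iota 0 i.+1).

Lemma coefM_Poly (K : nzRingType) (a b : seq K) i :
  (Poly a * Poly b)`_i = cauchy a b i.
Proof.
rewrite coefM -(big_mkord xpredT (fun j => (Poly a)`_j * (Poly b)`_(i - j))).
by under eq_bigr do rewrite !coef_Poly; rewrite unlock.
Qed.

(* Otherwise simplification unfolds Poly and coef_Poly no longer applies. *)
#[local] Arguments Poly : simpl never.

(** The second pass is for sums and products that surface once [/=] has decided the conditional left
    by [coefXnM]. *)
Ltac coef_compute :=
  rewrite ?(coefD, coefN, coefCM, coefXnM, coefM_Poly) /subn /=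
    ?(coefD, coefN, coefCM, coefM_Poly) ?(coefC, coefXn, coef_Poly)
    /cauchy /subn /=.

(** * Expansions of the solution and of the entries of L *)

Section garnier_jets.
Context {K : numFieldType} (hbar t2 alpha beta gamma delta : K).
Context {q1 q2 p1 p2 : K -> K} (x : K) (hbarN0 : hbar != 0).
Context (sol : laurent_solution hbar t2 alpha beta gamma delta q1 q2 p1 p2).

(** Dividing by [hbar] removes it from all denominators of the expansions. *)
Let u (t : K) := (t - alpha) / hbar.

Local Notation expands n f a := (jet alpha^' u n f (Poly a)).
Local Notation L11t t := (L11 (q1 t) (q2 t) (p1 t) x).
Local Notation L12t t := (L12 t t2 (q2 t) (p1 t) (p2 t) x).
Local Notation L21t t := (L21 t2 (p1 t) (p2 t) x).
Local Notation dL12t t := (dL12 t2 (p1 t) (p2 t) x).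
Local Notation R0x := (R0 t2 alpha beta gamma delta x).

Let u0 : u t @[t --> alpha^'] --> (0 : K).
Proof.
suff : u t @[t --> alpha^'] --> (alpha - alpha) / hbar by rewrite subrr mul0r.
apply: cvgM; last exact: cvg_cst.
by apply: cvgB; [exact: cvg_within|exact: cvg_cst].
Qed.

Let uN0 : \forall t \near alpha^', u t != 0.
Proof.
apply: filterS (nbhs_dnbhs_neq alpha) => t tN.
by rewrite mulf_neq0 ?invr_eq0// subr_eq0.
Qed.

Let alphaE t : t = alpha + hbar * u t.
Proof. by rewrite /u mulrC divfK// addrC subrK. Qed.

Let laurent_jet f head m k p : laurent_expansion alpha f head m.+1 ->
  (forall v, v != 0 -> v ^+ k * head (hbar * v) = p.[v]) ->
  jet alpha^' u (k + m) (fun t => u t ^+ k * f t) p.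
Proof.
move=> /laurent_remainder[e e0 fE] headE; exists (fun t => hbar ^+ m * e t).
  suff : hbar ^+ m * e t @[t --> alpha^'] --> hbar ^+ m * 0 by rewrite mulr0.
  by apply: cvgM => //; exact: cvg_cst.
apply: filterS2 uN0 fE => t utN0 ->; rewrite -headE//.
have -> : t - alpha = hbar * u t by rewrite /u mulrC divfK.
by rewrite [(hbar * _) ^+ m]exprMn exprD; ring.
Qed.

(* The heads of p2 and q1 are known to order 9, one more than the other two;
   their last coefficient only serves to match the whole head. *)
Definition p1_jet : seq K := [::
  1;
  0;
  beta / 2;
  0;
  - 3 * t2 / 5 - 3 * beta ^+ 2 / 4;
  - 4 * gamma;
  - 6 * t2 * beta / 7 + alpha / 7 - 5 * beta ^+ 3 / 4;
  - 3 * beta * gamma + hbar / 10;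
  18 * t2 ^+ 2 / 275 + 3 * t2 * beta ^+ 2 / 385 + 2 * alpha * beta / 77
    - beta ^+ 4 / 8 + delta / 11].

Definition q2_jet : seq K := [::
  - 1;
  0;
  0;
  0;
  - 3 * t2 / 5 - 3 * beta ^+ 2 / 4;
  - 6 * gamma;
  - 12 * t2 * beta / 7 + 2 * alpha / 7 - 5 * beta ^+ 3 / 2;
  - 15 * beta * gamma / 2 + hbar / 4;
  54 * t2 ^+ 2 / 275 + 9 * t2 * beta ^+ 2 / 385 + 6 * alpha * beta / 77
    - 3 * beta ^+ 4 / 8 + 3 * delta / 11].

Definition p2_jet : seq K := [::
  0;
  0;
  - 3 * beta / 2;
  0;
  t2 + 3 * beta ^+ 2 / 2;
  6 * gamma;
  9 * t2 * beta / 10 + 9 * beta ^+ 3 / 8;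
  hbar / 5;
  - 27 * t2 ^+ 2 / 110 - 9 * t2 * beta ^+ 2 / 308 - 15 * alpha * beta / 154
    + 15 * beta ^+ 4 / 32 + 9 * delta / 22;
  - 72 * t2 * gamma / 35 - 9 * beta ^+ 2 * gamma / 2 + 9 * beta * hbar / 140].

Definition q1_jet : seq K := [::
  - 1;
  0;
  beta;
  0;
  0;
  gamma;
  - 9 * t2 * beta / 35 + alpha / 7 - beta ^+ 3 / 2;
  - 15 * beta * gamma / 2 + 9 * hbar / 20;
  delta;
  18 * t2 * gamma / 7 - 15 * beta ^+ 2 * gamma / 2 + 5 * beta * hbar / 14].

Lemma jet_p1 : expands 8 (fun t => u t ^+ 2 * p1 t) p1_jet.
Proof.
have [_ [_ _ + _]] := sol => /laurent_jet; apply => v vN0.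
rewrite /p1_jet /Poly /= !cons_poly_def !hornerE /= /p1_head.
by field; rewrite hbarN0 vN0.
Qed.

Lemma jet_q2 : expands 8 (fun t => u t ^+ 3 * q2 t) q2_jet.
Proof.
have [_ [_ + _ _]] := sol => /laurent_jet; apply => v vN0.
rewrite /q2_jet /Poly /= !cons_poly_def !hornerE /= /q2_head.
by field; rewrite hbarN0 vN0.
Qed.

(** The weight 4 exceeds the pole order 2, hence two leading zeros. Weights 2, 3, 4, 5 for [p1],
    [q2], [p2], [q1] give the five terms of [H1] free of [t1] and [t2] the common weight 8, and all
    four series are then available to order 8. *)
Lemma jet_p2 : expands 8 (fun t => u t ^+ 4 * p2 t) p2_jet.
Proof.
suff : expands 9 (fun t => u t ^+ 4 * p2 t) p2_jet.
  by apply: jet_trunc.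
have [_ [_ _ _ +]] := sol => /laurent_jet; apply => v vN0.
rewrite /p2_jet /Poly /= !cons_poly_def !hornerE /= /p2_head.
by field; rewrite hbarN0 vN0.
Qed.

Lemma jet_q1 : expands 8 (fun t => u t ^+ 5 * q1 t) q1_jet.
Proof.
suff : expands 9 (fun t => u t ^+ 5 * q1 t) q1_jet.
  by apply: jet_trunc.
have [_ [+ _ _ _]] := sol => /laurent_jet; apply => v vN0.
rewrite /q1_jet /Poly /= !cons_poly_def !hornerE /= /q1_head.
by field; rewrite hbarN0 vN0.
Qed.

(** Kept as a list of its own so that [p1^3] is again a product of two lists, as [coefM_Poly]
    requires. *)
Definition p1sq_jet : seq K := [::
  1;
  0;
  beta;
  0;
  - 6 * t2 / 5 - 5 * beta ^+ 2 / 4;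
  - 8 * gamma;
  - 81 * t2 * beta / 35 + 2 * alpha / 7 - 13 * beta ^+ 3 / 4;
  - 10 * beta * gamma + hbar / 5;
  27 * t2 ^+ 2 / 55 + 9 * t2 * beta ^+ 2 / 154 + 15 * alpha * beta / 77
    - 15 * beta ^+ 4 / 16 + 2 * delta / 11].

Lemma jet_p1sq : expands 8 (fun t => u t ^+ 4 * p1 t ^+ 2) p1sq_jet.
Proof.
pose proof (jetM u0 jet_p1 jet_p1) as J.
(* With [k := 0] nothing is divided: the product is only replaced by its list of coefficients up to
   order 8. *)
apply: (jet_div u0 uN0 (k := 0) (n := 8) _ _ _ J).
- by apply: nearW => t; ring.
- by [].
- by do 9 (case=> [_|]; first by coef_compute; field).
Qed.

Definition L11_jet : seq K := [::
  - x + 3 * beta / 2;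
  0;
  0;
  3 * gamma;
  - 3 * x * t2 / 5 - 3 * x * beta ^+ 2 / 4 + 9 * t2 * beta / 10
    + 9 * beta ^+ 3 / 8;
  - 6 * x * gamma + 3 * hbar / 10;
  - 12 * x * t2 * beta / 7 + 2 * x * alpha / 7 - 5 * x * beta ^+ 3 / 2
    - 27 * t2 ^+ 2 / 55 - 9 * t2 * beta ^+ 2 / 154 - 15 * alpha * beta / 77
    + 15 * beta ^+ 4 / 16 + 9 * delta / 11].

(** [q1] and [p1 q2] both start with [- u^-5] and have no [u^-4] term, so their difference has a
    pole of order 3 only. *)
Lemma jet_L11 : expands 6 (fun t => u t ^+ 3 * L11t t) L11_jet.
Proof.
pose proof (jetB (jetD (jetM u0 (jetC x) (jetM u0 (jetXn 2) jet_q2)) jet_q1)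
  (jetM u0 jet_p1 jet_q2)) as J.
apply: (jet_div u0 uN0 (k := 2) (n := 6) _ _ _ J).
- by apply: nearW => t; rewrite /L11; ring.
- by do 2 (case=> [_|]; first by coef_compute; field).
- by do 7 (case=> [_|]; first by coef_compute; field).
Qed.

Definition L12_jet : seq K := [::
  x - 3 * beta / 2;
  0;
  x ^+ 2 - x * beta / 2 - 3 * beta ^+ 2 / 2;
  - 12 * gamma;
  x ^+ 3 + x ^+ 2 * beta / 2 + 9 * x * t2 / 5 + x * beta ^+ 2 / 4
    - 27 * t2 * beta / 10 - 39 * beta ^+ 3 / 8;
  - 2 * x * gamma - 18 * beta * gamma + hbar / 5;
  - 3 * x ^+ 2 * t2 / 5 - 3 * x ^+ 2 * beta ^+ 2 / 4
    - 99 * x * t2 * beta / 70 + 2 * x * alpha / 7 - 17 * x * beta ^+ 3 / 8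
    - 54 * t2 ^+ 2 / 55 - 1377 * t2 * beta ^+ 2 / 770 + 3 * alpha * beta / 77
    - 3 * beta ^+ 4 / 4 + 18 * delta / 11].

(** The order 6 poles of [p1^3] and [q2^2] cancel, and no order 5 pole occurs. *)
Lemma jet_L12 : expands 6 (fun t => u t ^+ 4 * L12t t) L12_jet.
Proof.
pose proof (jetD (jetB (jetD
  (jetD (jetM u0 (jetC (x ^+ 2 + t2)) (jetM u0 (jetXn 4) jet_p1))
        (jetM u0 (jetC x) (jetM u0 (jetXn 2) (jetD jet_p1sq jet_p2))))
  (jetD (jetM u0 jet_p1 jet_p1sq) (jetM u0 (jetC 2) (jetM u0 jet_p1 jet_p2))))
  (jetM u0 jet_q2 jet_q2))
  (* The explicit [- t1] in [L12] is [- alpha - hbar u]; its second part yields the [u^7] term. *)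
  (jetB (jetM u0 (jetC (x ^+ 3 + 2 * t2 * x - alpha)) (jetXn 6))
        (jetM u0 (jetC hbar) (jetXn 7)))) as J.
apply: (jet_div u0 uN0 (k := 2) (n := 6) _ _ _ J).
- apply: nearW => t; rewrite /L12; have := alphaE t.
  by move: (u t) => v ->; ring.
- by do 2 (case=> [_|]; first by coef_compute; field).
- by do 7 (case=> [_|]; first by coef_compute; field).
Qed.

Definition L21_jet : seq K := [::
  - x + 3 * beta / 2;
  0;
  x ^+ 2 - x * beta / 2 - 3 * beta ^+ 2 / 2;
  - 6 * gamma;
  3 * x * t2 / 5 + 3 * x * beta ^+ 2 / 4 - 9 * t2 * beta / 10
    - 9 * beta ^+ 3 / 8;
  4 * x * gamma - hbar / 5;
  6 * x * t2 * beta / 7 - x * alpha / 7 + 5 * x * beta ^+ 3 / 4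
    + 27 * t2 ^+ 2 / 110 + 9 * t2 * beta ^+ 2 / 308 + 15 * alpha * beta / 154
    - 15 * beta ^+ 4 / 32 - 9 * delta / 22].

Lemma jet_L21 : expands 6 (fun t => u t ^+ 2 * L21t t) L21_jet.
Proof.
pose proof (jetB (jetB (jetM u0 (jetC (x ^+ 2 + t2)) (jetXn 4))
  (jetM u0 (jetC x) (jetM u0 (jetXn 2) jet_p1))) jet_p2) as J.
apply: (jet_div u0 uN0 (k := 2) (n := 6) _ _ _ J).
- by apply: nearW => t; rewrite /L21; ring.
- by do 2 (case=> [_|]; first by coef_compute; field).
- by do 7 (case=> [_|]; first by coef_compute; field).
Qed.

Lemma jet_dL12 :
  expands 3 (fun t => u t ^+ 4 * dL12t t) [:: 1; 0; 2 * x - beta / 2].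
Proof.
pose proof (jetD (jetD (jetM u0 (jetC (3 * x ^+ 2 + 2 * t2)) (jetXn 4))
  (jetM u0 (jetC (2 * x)) (jetM u0 (jetXn 2) jet_p1)))
  (jetD jet_p1sq jet_p2)) as J.
apply: (jet_trunc u0 (n := 8)) (jet_near _ J) => //.
- by do 4 (case=> [_|]; first by coef_compute; field).
- by apply: nearW => t; rewrite /dL12; ring.
Qed.

Let y := x - 3 * beta / 2.

(** This is [- det L]. The poles of [L11^2] and [L12 L21] cancel down to a simple one, with [R0] as
    the constant term. *)
Lemma jet_det :
  expands 6 (fun t => u t ^+ 6 * (L11t t ^+ 2 + L12t t * L21t t))
    [:: 0; 0; 0; 0; 0; - hbar * y; R0x].
Proof.
pose proof (jetD (jetM u0 jet_L11 jet_L11) (jetM u0 jet_L12 jet_L21)) as J.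
apply: (jet_trunc u0 (n := 6)) (jet_near _ J) => //.
- by do 7 (case=> [_|]; first by coef_compute; rewrite /R0 /y; field).
- by apply: nearW => t; ring.
Qed.

(** Order 3 suffices: the quotient by [L12], of pole order 4, needs this combination only down to
    [u^-4]. *)
Lemma jet_cross :
  expands 3 (fun t => u t ^+ 7 * (q2 t * L12t t - L11t t * dL12t t))
    [:: 0; 0; y ^+ 2; 9 * gamma].
Proof.
(* [jetM] and [jetB] want both jets at the same order, here the 3 of [jet_dL12]. *)
have trunc3 n f p : (3 <= n)%N -> jet alpha^' u n f p -> jet alpha^' u 3 f p.
  by move=> n3; apply: jet_trunc.
pose proof (jetB (jetM u0 (trunc3 8 _ _ isT jet_q2) (trunc3 6 _ _ isT jet_L12))
  (jetM u0 (trunc3 6 _ _ isT jet_L11) jet_dL12)) as J.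
apply: (jet_trunc u0 (n := 3)) (jet_near _ J) => //.
- by do 4 (case=> [_|]; first by coef_compute; rewrite /y; field).
- by apply: nearW => t; ring.
Qed.

(** * The two limits *)

Context (xN : 2 * x != 3 * beta).

Let yE : 2 * x - 3 * beta = 2 * y.
Proof. by rewrite /y; field. Qed.

Let yN0 : y != 0.
Proof.
by apply: contra_neq xN => y0; apply/eqP; rewrite -subr_eq0 yE y0 mulr0.
Qed.

Lemma cvg_L12 : u t ^+ 4 * L12t t @[t --> alpha^'] --> y.
Proof. by apply: (jet_cvg u0 jet_L12); rewrite coef_Poly. Qed.

(** Numerator and denominator are both scaled by [u^4], which makes the denominator tend to the
    nonzero [y]. *)
Lemma cvg_div_L12 (f : K -> K) (l : K) : u t ^+ 4 * f t @[t --> alpha^'] --> l ->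
  f t / L12t t @[t --> alpha^'] --> l / y.
Proof.
move=> fl; apply: cvg_trans (cvgM fl (cvgV yN0 cvg_L12)); apply: near_eq_cvg.
apply: filterS uN0 => t utN0 /=.
by rewrite invfM mulrACA divff ?mul1r// expf_neq0.
Qed.

Lemma L12_neq0_near : \forall t \near alpha^', L12t t != 0.
Proof.
pose proof (cvgr_neq0 _ cvg_L12 yN0) as Lneq0.
by apply: filterS Lneq0 => t; apply: contra_neq => ->; rewrite mulr0.
Qed.

Lemma cvg_AGar92_2 :
  AGar92_2 t t2 (q2 t) (p1 t) (p2 t) x @[t --> alpha^'] --> 2 / (2 * x - 3 * beta).
Proof.
have -> : 2 / (2 * x - 3 * beta) = 1 / y by rewrite yE; field.
(* Only [p1^2] has a pole of order 4 in [M2_12], with leading coefficient 1. *)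
apply: cvg_div_L12.
pose proof (jetD (jetD (jetM u0 (jetC (x ^+ 2 + t2)) (jetXn 4))
  (jetM u0 (jetC x) (jetM u0 (jetXn 2) jet_p1)))
  (jetD jet_p1sq (jetM u0 (jetC 2) jet_p2))) as J.
apply: (jet_cvg u0 (jet_near _ J)).
- by apply: nearW => t; rewrite /M2_12; ring.
- by coef_compute; ring.
Qed.

Lemma cvg_QGar92 :
  QGar92 hbar t t2 (q1 t) (q2 t) (p1 t) (p2 t) x @[t --> alpha^']
    --> R0x + hbar * R1 beta gamma x + hbar ^+ 2 * R2 beta x.
Proof.
pose D t := (L11t t ^+ 2 + L12t t * L21t t) * L12t t
  + hbar * (q2 t * L12t t - L11t t * dL12t t).
have DL : D t / L12t t @[t --> alpha^'] --> R0x + 9 * hbar * gamma / y.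
  have -> : R0x + 9 * hbar * gamma / y = (y * R0x + 9 * hbar * gamma) / y.
    by field.
  apply: cvg_div_L12.
  (* Built by hand: the factor [u^3] lifts the order from 3 to 6, whereas [jetM] would keep it at
     3. *)
  have J3 : expands 6 (fun t => hbar * u t ^+ 3 * (u t ^+ 7 *
     (q2 t * L12t t - L11t t * dL12t t)))
     [:: 0; 0; 0; 0; 0; hbar * y ^+ 2; hbar * (9 * gamma)].
    have [e e0 cE] := jet_cross; exists (fun t => hbar * e t).
      suff : hbar * e t @[t --> alpha^'] --> hbar * 0 by rewrite mulr0.
      by apply: cvgM => //; exact: cvg_cst.
    apply: filterS cE => t; move: (u t) => v ->.
    by rewrite /Poly /= !cons_poly_def !hornerE /=; ring.
  pose proof (jetD (jetM u0 jet_det jet_L12) J3) as J.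
  suff JD : jet alpha^' u 0 (fun t => u t ^+ 4 * D t) (y * R0x + 9 * hbar * gamma)%:P.
    by apply: (jet_cvg u0 JD); rewrite coefC.
  (* In degree 5, [- hbar y^2] from the determinant meets [hbar y^2] from [J3]: the simple poles
     cancel. Degree 6 is the limit. *)
  apply: (jet_div u0 uN0 (k := 6) (n := 0) _ _ _ J).
  - by apply: nearW => t; rewrite /D; ring.
  - by do 6 (case=> [_|]; first by coef_compute; rewrite /y; field).
  - by case=> [_|//]; coef_compute; rewrite /y; field.
have dLL : dL12t t / L12t t @[t --> alpha^'] --> 1 / y.
  by apply: cvg_div_L12; apply: (jet_cvg u0 jet_dL12); rewrite coef_Poly.
(* The double pole of [p1] is too weak against the order 4 pole of [L12]. *)
have ddLL : (3 * x + p1 t) / L12t t @[t --> alpha^'] --> 0 / y.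
  apply: cvg_div_L12.
  pose proof (jetD (jetM u0 (jetC (3 * x)) (jetXn 4))
    (jetM u0 (jetXn 2) jet_p1)) as J.
  apply: (jet_cvg u0 (jet_near _ J)).
  - by apply: nearW => t; ring.
  - by coef_compute; ring.
have -> : R0x + hbar * R1 beta gamma x + hbar ^+ 2 * R2 beta x
  = R0x + 9 * hbar * gamma / y + hbar ^+ 2 * (3 / 4 * (1 / y * (1 / y)) - 0 / y).
  by rewrite /R1 /R2 yE; field.
suff lim : D t / L12t t + hbar ^+ 2 * (3 / 4
      * (dL12t t / L12t t * (dL12t t / L12t t))
      - (3 * x + p1 t) / L12t t) @[t --> alpha^'] -->
    R0x + 9 * hbar * gamma / y
    + hbar ^+ 2 * (3 / 4 * (1 / y * (1 / y)) - 0 / y).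
  apply: cvg_trans lim; apply: near_eq_cvg.
  by apply: filterS L12_neq0_near => t Lt0; rewrite QGar92E.
apply: cvgD => //; apply: cvgM; first exact: cvg_cst.
apply: cvgB => //; apply: cvgM; first exact: cvg_cst.
exact: cvgM.
Qed.

End garnier_jets.

Theorem theorem3p3 (R : realType)
    (hbar t2 alpha beta gamma delta : Cplx R)
    (q1 q2 p1 p2 : Cplx R -> Cplx R) (x : Cplx R)
    (hbar_neq0 : hbar != 0)
    (sol : laurent_solution hbar t2 alpha beta gamma delta q1 q2 p1 p2)
    (xN : 2 * x != 3 * beta) :
  QGar92 hbar t t2 (q1 t) (q2 t) (p1 t) (p2 t) x @[t --> alpha^']
    --> R0 t2 alpha beta gamma delta x
        + hbar * R1 beta gamma x + hbar ^+ 2 * R2 beta x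
  /\
  AGar92_2 t t2 (q2 t) (p1 t) (p2 t) x @[t --> alpha^']
    --> 2 / (2 * x - 3 * beta).
Proof.
split; first exact: (cvg_QGar92 hbar_neq0 sol xN).
exact: (cvg_AGar92_2 hbar_neq0 sol xN).
Qed.
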